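(* Let $X$ be a compact Hausdorff space and $X=Y\cup Z$, where $Y$ is a proper dense subspace of $X$ which is an E-space, and $Z$ is $F_{\aleph_0}$-embedded in $X$. Then $X\neq \beta Y$ (i.e., $X$ is not the Stone–Čech compactification of $Y$).
   Context: ''Space'' means topological $T_0$-space. A subset of a space $X$ is a zero-set (resp. cozero-set) if it is $f^{-1}(0)$ (resp. $X\setminus f^{-1}(0)$) for some continuous $f:X\to[0,1]$. A U-representation of a subset $V$ of $X$ is a sequence $(U_n(V))_{n\in\mathbb{N}}$ with $V=\bigcup_n U_n(V)$, $U_n(V)\subseteq U_{n+1}(V)$, $U_{2n-1}(V)$ a zero-set and $U_{2n}(V)$ a cozero-set for all $n\geq 1$. A family $\alpha$ of subsets of $X$ is an almost subbase of $X$ if one can choose a U-representation of each $V\in\alpha$ such that $\alpha\cup\{X\setminus U_{2n-1}(V): V\in\alpha, n\in\mathbb{N}\}$ is a subbase of $X$. A family of subsets of a set is strongly point-finite if every countably infinite subfamily contains a finite subfamily with empty intersection; $\sigma$-strongly point-finite means a countable union of strongly point-finite families. A space is an E-space if it has a $\sigma$-strongly point-finite almost subbase. A family $\mathcal{U}$ of subsets of $X$ F-separates $S\subseteq X$ if for distinct $x,y\in S$ there is $U\in\mathcal{U}$ with $x\in U$, $y\notin\mathrm{cl}_X(U)$, or vice versa. For a cardinal $\tau$, a subspace $S$ of $X$ is $F_\tau$-embedded in $X$ if there is a family of open subsets of $X$ which is the union of $\tau$ point-finite families of open subsets of $X$ and which F-separates $S$. *)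

(* Defs.v *)
From HB Require Import structures.
From mathcomp Require Import all_boot all_order all_algebra.
From mathcomp Require Import all_classical all_reals all_analysis.
From mathcomp Require Import Rstruct Rstruct_topology.

Set Implicit Arguments.
Unset Strict Implicit.
Unset Printing Implicit Defensive.

Import Order.TTheory GRing.Theory Num.Theory.
Local Open Scope classical_set_scope.
Local Open Scope ring_scope.

Notation Real := Rdefinitions.R.

Section Defs.
Context {T : topologicalType}.

Definition zero_set (A : set T) : Prop :=
  exists f : T -> Real, continuous f /\ (forall x, 0 <= f x <= 1) /\
    A = f @^-1` [set 0].

Definition cozero_set (A : set T) : Prop :=
  exists f : T -> Real, continuous f /\ (forall x, 0 <= f x <= 1) /\
    A = ~` (f @^-1` [set 0]).

(* U-representation of V, indexed from 0: U k here is U_{k+1} of the paper.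
   So U (2n) (= U_{2n+1}) is a zero-set and U (2n+1) (= U_{2n+2}) is a
   cozero-set. *)
Definition U_representation (V : set T) (U : nat -> set T) : Prop :=
  V = \bigcup_n U n /\ (forall n, U n `<=` U n.+1) /\
  (forall n, zero_set (U n.*2)) /\ (forall n, cozero_set (U n.*2.+1)).

Definition subbase (B : set (set T)) : Prop :=
  (forall S, B S -> open S) /\
  (forall (W : set T) (x : T), open W -> W x ->
     exists G : set (set T), [/\ finite_set G, G `<=` B,
        (\bigcap_(S in G) S) x & \bigcap_(S in G) S `<=` W]).

(* alpha is an almost subbase of T. The complements X \ U_{2n-1}(V) of the
   paper are the ~` U (2n) here (index shift). *)
Definition almost_subbase (alpha : set (set T)) : Prop :=
  exists U : set T -> nat -> set T,
    (forall V, alpha V -> U_representation V (U V)) /\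
    subbase (alpha `|` [set ~` U V n.*2 | V in alpha & n in [set: nat]]).

End Defs.

Definition strongly_point_finite {T : Type} (F : set (set T)) : Prop :=
  forall S : set (set T), S `<=` F -> countable S -> infinite_set S ->
    exists G : set (set T), [/\ G `<=` S, finite_set G, G !=set0 &
      \bigcap_(A in G) A = set0].

Definition sigma_strongly_point_finite {T : Type} (F : set (set T)) : Prop :=
  exists Fn : nat -> set (set T),
    F = \bigcup_n Fn n /\ forall n, strongly_point_finite (Fn n).

Definition E_space (T : topologicalType) : Prop :=
  exists alpha : set (set T),
    almost_subbase alpha /\ sigma_strongly_point_finite alpha.

Definition point_finite {T : Type} (F : set (set T)) : Prop :=
  forall x : T, finite_set [set A | F A /\ A x].

Definition F_separates {X : topologicalType} (Uf : set (set X)) (S : set X)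
  : Prop :=
  forall x y, S x -> S y -> x <> y ->
    exists2 U, Uf U &
      ((U x /\ ~ closure U y) \/ (U y /\ ~ closure U x)).

Definition F_aleph0_embedded {X : topologicalType} (S : set X) : Prop :=
  exists Fn : nat -> set (set X),
    (forall n, point_finite (Fn n)) /\
    (forall n U, Fn n U -> open U) /\
    F_separates (\bigcup_n Fn n) S.

Definition is_stone_cech (X : topologicalType) (Y : set X) : Prop :=
  [/\ compact [set: X], hausdorff_space X, closure Y = [set: X] &
    forall (K : topologicalType) (f : set_type Y -> K),
      compact [set: K] -> hausdorff_space K -> continuous f ->
      exists g : X -> K, continuous g /\ forall y : set_type Y, g (\val y) = f y].

(* Main.v *)
(* If [X] were the Stone-Cech compactification of [Y], the functions attached to
   the almost subbase of [Y] would extend to [X]; their positivity sets are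
   point-finite on [X] because a finite intersection of them is open, hence meets
   [Y]. With the family given on [Z] they yield a sigma-point-finite open family
   that F-separates all of [X]. By a Baire category argument, every non-isolated
   point of such a compact space, in particular every [p] outside [Y], is the
   limit of a sequence of disjoint nonempty open sets. This gives a bounded
   continuous function on [Y] oscillating at [p], which cannot extend to [X]. *)

Require Import Defs.
From HB Require Import structures.
From mathcomp Require Import all_boot all_order all_algebra.
From mathcomp Require Import all_classical all_reals all_analysis.
From mathcomp Require Import Rstruct Rstruct_topology.
From mathcomp Require Import lra.

Import Order.TTheory GRing.Theory Num.Theory numFieldNormedType.Exports.

Local Open Scope classical_set_scope.
Local Open Scope ring_scope.

(** * Dependent choice, and compactness and density tools *)

(** Plain dependent choice on the subtype of pairs (stage, state) satisfying [P]; the counter grows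
    by one at each step, so it equals the index. *)
Lemma dependent_choice_inv (T : Type) (P : nat -> T -> Prop)
    (R : nat -> T -> T -> Prop) :
  (exists t, P 0%N t) ->
  (forall n t, P n t -> exists2 t', P n.+1 t' & R n t t') ->
  exists f : nat -> T, forall n, P n (f n) /\ R n (f n) (f n.+1).
Proof.
move=> [t0 Pt0] step; pose S := {s : nat * T | P s.1 s.2}.
pose next (x y : S) :=
  (sval y).1 = (sval x).1.+1 /\ R (sval x).1 (sval x).2 (sval y).2.
have step' (x : S) : {y | next x y}.
  apply: cid; case: x => -[n t] Pt; have [t' Pt' Rtt'] := step _ _ Pt.
  by exists (exist _ (n.+1, t') Pt').
have [f [f0 fR]] := dependent_choice step' (exist _ (0%N, t0) Pt0).
have f1 n : (sval (f n)).1 = n.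
  by elim: n => [|n IH]; [rewrite f0|have [-> _] := fR n; rewrite IH].
exists (fun n => (sval (f n)).2) => n; split.
  by rewrite -[X in P X]f1; exact: svalP (f n).
by have [_] := fR n; rewrite f1.
Qed.

Lemma open_bigcap_finite (X : topologicalType) (I : choiceType) (D : set I)
    (F : I -> set X) :
  finite_set D -> (forall i, D i -> open (F i)) -> open (\bigcap_(i in D) F i).
Proof.
move=> finD oF; rewrite -[X in open X]setCK setC_bigcap; apply: closed_openC.
by apply: closed_bigcup => // i Di; apply: open_closedC; exact: oF.
Qed.

Lemma compact_cluster_seq (X : topologicalType) (u : nat -> X) :
  compact [set: X] ->
  exists z : X, forall B n, nbhs z B -> exists2 k, (n <= k)%N & B (u k).
Proof.
move=> cX; have [|z [_ clz]] := cX (u @ \oo) _.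
  exact: filterT.
exists z => B n Bz.
have /(clz _ B) : (u @ \oo) (u @` [set k | (n <= k)%N]).
  by exists n => // k /= nk; exists k.
by move=> /(_ Bz) [_ [[k nk <-] Bk]]; exists k.
Qed.

Lemma open_shrink (X : topologicalType) (V : set X) (x : X) :
  compact [set: X] -> hausdorff_space X -> open V -> V x ->
  exists W, [/\ open W, W x & closure W `<=` V].
Proof.
move=> cX hX oV Vx.
have /(_ _ V (open_nbhs_nbhs (conj oV Vx)))[B xB BV] :=
  @compact_regular X x setT hX cX filterT.
exists B°; split; first exact: open_interior; first by [].
by apply: subset_trans BV; apply: closure_subset; exact: interior_subset.
Qed.

Lemma dense_open_meets (X : topologicalType) (Y A : set X) (x : X) :
  closure Y = [set: X] -> open A -> A x -> exists y : set_type Y, A (\val y).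
Proof.
move=> dY oA Ax; have : closure Y x by rewrite dY.
move=> /(_ _ (open_nbhs_nbhs (conj oA Ax)))[y [Yy Ay]].
by exists (exist _ y (mem_set Yy)).
Qed.

(** * Point-finite families and convergent sequences of open sets *)

(* Otherwise one could shrink [O] forever, each time into a new member of [F],
   and a point of the intersection would lie in infinitely many members. *)
Lemma point_finite_locally_finite (X : topologicalType) (F : set (set X))
    (O : set X) :
  compact [set: X] -> hausdorff_space X ->
  point_finite F -> (forall U, F U -> open U) -> open O -> O !=set0 ->
  exists W, [/\ open W, W !=set0, W `<=` O &
    finite_set [set U | F U /\ U `&` W !=set0]].
Proof.
move=> cX hX pfF oF oO [x0 Ox0]; apply: contrapT => noW.
(* A state is an open set together with [n] distinct members of [F] that contain it. *)
pose good n (s : set X * seq (set X)) :=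
  size s.2 = n /\ [/\ open s.1, s.1 !=set0, s.1 `<=` O, uniq s.2 &
      forall U, U \in s.2 -> F U /\ s.1 `<=` U].
pose next (s t : set X * seq (set X)) := closure t.1 `<=` s.1.
have [f fP] : exists f : nat -> set X * seq (set X),
    forall n, good n (f n) /\ next (f n) (f n.+1).
  apply: (@dependent_choice_inv _ good (fun=> next)).
    by exists (O, [::]); split => //; split => //; exists x0.
  move=> n [W s] [/= sn [oW W0 WO us sP]].
  have infW : infinite_set [set U | F U /\ U `&` W !=set0].
    by move=> finW; apply: noW; exists W.
  have [U [[FU [x [Ux Wx]]] /negP sU]] :
      exists U, (F U /\ U `&` W !=set0) /\ ~ U \in s.
    apply: contrapT => noU; apply: infW.
    apply: (sub_finite_set _ (finite_seq s)).
    by move=> U FU /=; apply: contrapT => Us; apply: noU; exists U.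
  have [|//|W' [oW' W'x W'WU]] := @open_shrink X (W `&` U) x cX hX.
    by apply: openI => //; exact: oF.
  have W'W : W' `<=` W `&` U by apply: subset_trans W'WU; exact: subset_closure.
  exists (W', U :: s); last by move=> y /W'WU[].
  split; rewrite /= ?sn//; split => //.
  - by exists x.
  - by move=> y /W'W[/WO].
  - by rewrite sU.
  - move=> V; rewrite inE => /orP[/eqP->|/sP[FV WV]].
      by split => // y /W'W[].
    by split => // y /W'W[/WV].
have fsub m n : (m <= n)%N -> (f n).1 `<=` (f m).1.
  elim: n => [|n IH]; first by rewrite leqn0 => /eqP->.
  rewrite leq_eqVlt => /orP[/eqP->//|/IH]; apply: subset_trans.
  by have [_] := fP n; apply: subset_trans; exact: subset_closure.
have /choice[u uP] n : exists x, (f n).1 x by have [[_ []]] := fP n.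
have [z zP] := compact_cluster_seq X u cX.
(* The closure of each open set lies in the previous one, so the cluster point lies in all of
   them. *)
have fz n : (f n).1 z.
  have [_ +] := fP n; apply => B zB.
  have [k nk Bk] := zP B n.+1 zB.
  by exists (u k); split => //; apply: fsub nk _ (uP k).
have /finite_seqP[s sE] := pfF z.
(* At this stage there is one more distinct member around [z] than [s] can list. *)
have [[fs [_ _ _ us sF]] _] := fP (size s).+1.
have : (size (f (size s).+1).2 <= size s)%N.
  apply: uniq_leq_size => // U Us; have [FU fU] := sF _ Us.
  suff : [set` s] U by [].
  by rewrite -sE; split => //; apply: fU.
by rewrite fs ltnn.
Qed.

(* [W k] is taken inside [B k], an open neighbourhood of [p], so as to meet only
   finitely many members of the first [k] families; [B k.+1] avoids those whose
   closure misses [p]. A cluster point of the [W k] is then not separated from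
   [p] by any member. *)
Lemma convergent_open_sets (X : topologicalType) (p : X) :
  compact [set: X] -> hausdorff_space X -> F_aleph0_embedded [set: X] ->
  ~ open [set p] ->
  exists W : nat -> set X,
    [/\ forall k, open (W k), forall k, W k !=set0,
        forall j k, (j < k)%N -> W j `&` W k = set0 &
        forall B, open B -> B p -> exists n,
          forall k, (n <= k)%N -> W k `<=` B].
Proof.
move=> cX hX [F [pfF [oF sepF]]] np.
pose G n := \bigcup_(i in [set i | (i <= n)%N]) F i.
have FG i n : (i <= n)%N -> F i `<=` G n by move=> le_in U FU; exists i.
have oG n U : G n U -> open U by move=> [i _]; exact: oF.
have pfG n : point_finite (G n).
  move=> x; rewrite (_ : mkset _ =
      \bigcup_(i in [set i | (i <= n)%N]) [set A | F i A /\ A x]).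
    by apply: bigcup_finite => [|i _]; [exact: finite_II n.+1|exact: pfF].
  by apply/seteqP; split=> [U [[i ni FU] Ux]|U [i ni [FU Ux]]];
    [exists i|split => //; exists i].
pose good n (s : set X * set X) := let: (B, W) := s in
  [/\ open B, B p, W !=set0, W `<=` B & ~ closure W p] /\
  [/\ open W, finite_set [set U | G n U /\ U `&` W !=set0] &
      forall U, G n U -> U p -> B `<=` U].
pose next n (s s' : set X * set X) :=
  let: (B, W) := s in let: (B', W') := s' in
  [/\ B' `<=` B, B' `&` W = set0 &
      forall U, G n U -> U `&` W !=set0 -> ~ closure U p -> B' `&` U = set0].
have extend n B : open B -> B p -> exists B' W, good n (B', W) /\ B' `<=` B.
  move=> oO Op.
  (* Only finitely many members of [G n] contain [p], so shrinking [B] into all of them keeps it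
     open. *)
  pose B' := B `&` \bigcap_(U in [set U | G n U /\ U p]) U.
  have oO' : open B'.
    apply: openI => //; apply: open_bigcap_finite; first exact: pfG.
    by move=> U [/oG].
  have B'p : B' p by split => // U [].
  have [x [B'x xp]] : exists x, B' x /\ x <> p.
    apply: contrapT => nox; apply: np; rewrite (_ : [set p] = B')//.
    apply/seteqP; split=> [_ ->//|x B'x /=].
    by apply: contrapT => xp; apply: nox; exists x.
  have oV : open (B' `\ p).
    apply: openI => //; apply: closed_openC.
    exact: accessible_closed_set1 (hausdorff_accessible hX) p.
  have [//|V [oVV Vx VO']] := open_shrink X (B' `\ p) x cX hX oV.
  have [W [oW W0 WV finW]] := point_finite_locally_finite X (G n) V cX hX
    (pfG n) (oG n) oVV (ex_intro _ x Vx).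
  have WO' : closure W `<=` B' `\ p.
    by apply: subset_trans VO'; exact: closure_subset.
  exists B', W; split; last by move=> y [].
  split; split => //.
  - by move=> y /subset_closure /WO'[].
  - by move=> /WO'[_]; exact.
  - by move=> U GU Up y [_]; exact.
have [f fP] : exists f : nat -> set X * set X,
    forall n, good n (f n) /\ next n (f n) (f n.+1).
  apply: (@dependent_choice_inv _ good next).
    by have [B [W [OW _]]] := extend 0%N setT openT Logic.I; exists (B, W).
  move=> n [B W] [[oO Op W0 WO pW] [oW finW BU]].
  pose D := [set U | (G n U /\ U `&` W !=set0) /\ ~ closure U p].
  (* [D] is finite because [W] meets finitely many members of [G n]; hence [B1] is open. *)
  pose B1 := B `&` ~` closure W `&` \bigcap_(U in D) ~` closure U.
  have oO1 : open B1.
    apply: openI.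
      by apply: openI => //; exact/closed_openC/closed_closure.
    apply: open_bigcap_finite => [|U _]; last exact/closed_openC/closed_closure.
    by apply: sub_finite_set finW => U [].
  have O1p : B1 p by split => // U [].
  have [B' [W' [gW' B'B1]]] := extend n.+1 B1 oO1 O1p.
  exists (B', W') => //; split => //.
  - by move=> x /B'B1[[]].
  - apply/seteqP; split => // x [/B'B1[[_ +] _] Wx].
    by apply; exact: subset_closure.
  - move=> U GU UW Up; apply/seteqP; split => // x [/B'B1[_ +] Ux].
    by move=> /(_ U)/=; apply; [split|exact: subset_closure].
pose B k := (f k).1; pose W k := (f k).2.
have {}fP k : [/\
    [/\ open (B k), B k p, W k !=set0, W k `<=` B k & ~ closure (W k) p],
    [/\ open (W k), finite_set [set U | G k U /\ U `&` W k !=set0] &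
      forall U, G k U -> U p -> B k `<=` U] &
    [/\ B k.+1 `<=` B k, B k.+1 `&` W k = set0 &
      forall U, G k U -> U `&` W k !=set0 -> ~ closure U p ->
        B k.+1 `&` U = set0]].
  by have := fP k; rewrite /B /W; case: (f k) (f k.+1) => [? ?] [? ?] [[]].
have subO m n : (m <= n)%N -> B n `<=` B m.
  elim: n => [|n IH]; first by rewrite leqn0 => /eqP->.
  rewrite leq_eqVlt => /orP[/eqP->//|/IH]; apply: subset_trans.
  by have [_ _ []] := fP n.
have WO m n : (m <= n)%N -> W n `<=` B m.
  by move=> mn; apply: subset_trans (subO _ _ mn); have [[]] := fP n.
exists W; split.
- by move=> k; have [_ []] := fP k.
- by move=> k; have [[]] := fP k.
- move=> j k jk; apply/seteqP; split => // x [Wj /(WO _ _ jk) Oj].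
  by have [_ _ [_ <- _]] := fP j.
move=> N oN Np; apply: contrapT => /forallNP noN.
have /choice[u uP] n : exists x, exists2 k, (n <= k)%N & W k x /\ ~ N x.
  have /existsNP[k /not_implyP[nk /existsNP[x /not_implyP[Wx Nx]]]] := noN n.
  by exists x, k.
have [z zP] := compact_cluster_seq X u cX.
have Nz : ~ N z.
  move=> Nz; have [k _ Nk] := zP N 0%N (open_nbhs_nbhs (conj oN Nz)).
  by have [? _ []] := uP k.
have [|U [i _ FU] [[Up Uz]|[Uz Up]]] := sepF p z Logic.I Logic.I.
- by move=> pz; apply: Nz; rewrite -pz.
(* If [p] is in [U], then [U] contains [B l], hence [W l], for all [l >= i], so the sequence cannot
   cluster outside [closure U]. *)
- have [|k ik Uk] := zP (~` closure U) i.
    by apply: open_nbhs_nbhs; split => //; exact/closed_openC/closed_closure.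
  have [l kl [Wl _]] := uP k; apply: Uk; apply: subset_closure.
  have [_ [_ _ +] _] := fP l; apply => //; last exact: WO Wl.
  exact: FG (leq_trans ik kl) U FU.
(* If [z] is in [U], then [U] meets some late [W l], so [B l.+1] avoids [U]; yet later terms of the
   sequence return to [U]. *)
- have zU : nbhs z U by apply: open_nbhs_nbhs; split => //; exact: oF FU.
  have [k ik Uk] := zP U i zU; have [l kl [Wl _]] := uP k.
  have [_ _ [_ _ BU]] := fP l.
  have [m lm Um] := zP U l.+1 zU; have [j mj [Wj _]] := uP m.
  have BlU : B l.+1 `&` U = set0.
    by apply: BU => //; [exact: FG (leq_trans ik kl) U FU|exists (u k)].
  suff : (B l.+1 `&` U) (u m) by rewrite BlU.
  by split => //; apply: WO Wj; exact: leq_trans lm mj.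
Qed.

(** * Extension of functions with values in the unit interval *)

Lemma compact_set_type (T : topologicalType) (A : set T) :
  compact A -> compact [set: set_type A].
Proof.
move=> cA F FF _.
have [|x [Ax clx]] := cA (\val @ F) _.
  by apply: (@filterS _ F _ setT) filterT => y _; exact: set_valP.
exists (exist _ x (mem_set Ax)); split => // P Q FP [_ [/= [V oV <-]] Vx VQ].
have [||_ [[y Py <-] Vy]] := clx (\val @` P) V.
- by apply: (@filterS _ F _ P) FP => y Py; exists y.
- exact: open_nbhs_nbhs.
- by exists y; split => //; exact: VQ.
Qed.

Lemma hausdorff_set_type (T : topologicalType) (A : set T) :
  hausdorff_space T -> hausdorff_space (set_type A).
Proof.
move=> hT x y cl; apply: val_inj; apply: hT => P Q xP yQ.
have [||z [Pz Qz]] := cl (set_val @^-1` P) (set_val @^-1` Q).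
- exact: (@initial_continuous (set_type A) T set_val x).
- exact: (@initial_continuous (set_type A) T set_val y).
- by exists (\val z).
Qed.

(** The extension property concerns compact Hausdorff targets, so [f] is first corestricted to the
    subtype of the unit interval. *)
Lemma stone_cech_extension (R : realType) (X : topologicalType) (Y : set X)
    (f : set_type Y -> R) :
  is_stone_cech Y -> continuous f -> (forall y, 0 <= f y <= 1) ->
  exists g : X -> R,
    [/\ continuous g, forall y, g (\val y) = f y & forall x, 0 <= g x <= 1].
Proof.
move=> [_ _ _ ext] cf f01.
pose I : set R := `[0, 1]%classic.
have fI y : f y \in I by rewrite inE /I /= in_itv /=; exact: f01.
have [|||g [cg gf]] := ext (set_type I) (fun y => exist _ (f y) (fI y)).
- by apply: compact_set_type; exact: segment_compact.
- by apply: hausdorff_set_type; exact: Rhausdorff.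
- exact: (@continuous_comp_initial _ _ _ (set_val : set_type I -> R)).
exists (fun x => \val (g x)); split.
- move=> x; apply: continuous_comp; first exact: cg.
  exact: (@initial_continuous (set_type I) R set_val).
- by move=> y; rewrite gf.
- by move=> x; have := set_valP (g x); rewrite /I /= in_itv.
Qed.

(** * Locally finite series and the oscillating function *)

Lemma lim_series_eventually0 (R : realType) (a : nat -> R) m :
  (forall k, (m <= k)%N -> a k = 0) ->
  lim (series a @ \oo) = \sum_(0 <= k < m) a k.
Proof.
move=> a0; apply: lim_near_cst; first exact: Rhausdorff.
exists m => // n /= mn; rewrite /series /= (big_cat_nat (leq0n m) mn)//=.
rewrite [X in _ + X]big_nat_cond [X in _ + X]big1 ?addr0//.
by move=> i /andP[/andP[mi _] _]; exact: a0.
Qed.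

(** Near [x] the series coincides with the finite sum of its first [m] terms. *)
Lemma continuous_lim_series (R : realType) (X : topologicalType)
    (h : nat -> X -> R) (x : X) m :
  (forall k, continuous (h k)) ->
  (\forall x' \near x, forall k, (m <= k)%N -> h k x' = 0) ->
  {for x, continuous (fun x => lim (series (h^~ x) @ \oo))}.
Proof.
move=> ch h0.
have hE : \forall x' \near x,
    \sum_(0 <= k < m) h k x' = lim (series (h^~ x') @ \oo).
  by apply: filterS h0 => x' hx'; rewrite (lim_series_eventually0 R _ m).
apply: cvg_trans (near_eq_cvg hE) _.
rewrite -(nbhs_singleton hE); move: x {h0 hE}.
by apply: continuous_big => // z; exact: add_continuous.
Qed.

Lemma open_bump (R : realType) (X : topologicalType) (V : set X) (x : X) :
  compact [set: X] -> hausdorff_space X -> open V -> V x ->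
  exists h : X -> R,
    [/\ continuous h, h x = 1 & forall y, ~ V y -> h y = 0].
Proof.
move=> cX hX oV Vx.
have [||||h [ch h0 h1 _]] := @urysohn_ext_itv X R (compact_normal hX cX)
  (~` V) [set x] 0 1.
- exact: open_closedC.
- exact: accessible_closed_set1 (hausdorff_accessible hX) x.
- by apply/seteqP; split => // y [Vy yx]; apply: Vy; rewrite yx.
- exact: ltr01.
exists h; split => //; first by apply: h1; exists x.
by move=> y Vy; apply: h0; exists y.
Qed.

(* A sum of bumps supported on the even [W k] is locally finite away from [p],
   hence continuous on [Y], but it oscillates between [0] and [1] at [p]. *)
Lemma stone_cech_no_convergent_open_sets (R : realType) (X : topologicalType)
    (Y : set X) (p : X) (W : nat -> set X) :
  is_stone_cech Y -> ~ Y p ->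
  (forall k, open (W k)) -> (forall k, W k !=set0) ->
  (forall j k, (j < k)%N -> W j `&` W k = set0) ->
  ~ (forall B, open B -> B p -> exists n, forall k, (n <= k)%N -> W k `<=` B).
Proof.
move=> scY Yp oW W0 disjW cvgW; have [cX hX dY _] := scY.
have /choice[u uP] k : exists y : set_type Y, W k (\val y).
  by have [x Wx] := W0 k; exact: dense_open_meets dY (oW k) Wx.
have /choice[h hP] k : exists h : X -> R,
    [/\ continuous h, h (\val (u k.*2)) = 1 & forall y, ~ W k.*2 y -> h y = 0].
  exact: open_bump.
have h0 j k : j != k.*2 -> h k (\val (u j)) = 0.
  move=> jk; have [_ _ -> //] := hP k => Wu.
  have [/disjW dj|/disjW dj|/eqP] := ltngtP j k.*2; last by rewrite (negbTE jk).
    have : (W j `&` W k.*2) (\val (u j)) by split.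
    by rewrite dj.
  have : (W k.*2 `&` W j) (\val (u j)) by split.
  by rewrite dj.
pose H x : R := lim (series (h^~ x) @ \oo).
have ctsH x : x != p -> {for x, continuous H}.
  move=> xp.
  move: (hX); rewrite open_hausdorff => /(_ _ _ xp)[[A B]] /=.
  rewrite !inE => -[Ax Bp] [oA oB AB].
  have [n nB] := cvgW B oB Bp.
  apply: (@continuous_lim_series R X h x n); first by move=> k; have [] := hP k.
  have : nbhs x A by exact: open_nbhs_nbhs.
  apply: filterS => z Az k nk; have [_ _ -> //] := hP k => Wz.
  suff : (A `&` B) z by rewrite AB.
  split => //; apply: nB Wz.
  by rewrite (leq_trans nk)// -addnn leq_addr.
have Heven k : H (\val (u k.*2)) = 1.
  rewrite /H (lim_series_eventually0 R _ k.+1) => [|j kj]; last first.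
    by rewrite h0// eq_sym neq_ltn !ltn_double kj orbT.
  rewrite big_nat_recr//= big_nat_cond big1 ?add0r; first by have [] := hP k.
  by move=> j /andP[/andP[_ jk] _]; rewrite h0// neq_ltn !ltn_double jk orbT.
have Hodd k : H (\val (u k.*2.+1)) = 0.
  rewrite /H (lim_series_eventually0 R _ 0%N) ?big_geq// => j _; rewrite h0//.
  by apply/eqP => /(congr1 odd); rewrite /= !odd_double.
have [||g [cg gH _]] := @stone_cech_extension R X Y
  (* Truncation forces values into the unit interval and preserves the values 0 and 1. *)
  (fun y => Num.min 1 `|H (\val y)|) scY.
- move=> y; apply: (@continuous_min R (set_type Y) (cst 1)
    (fun y => `|H (set_val y)|)); first exact: cst_continuous.
  apply: (@continuous_comp _ _ _ (fun y : set_type Y => H (set_val y))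
    Num.norm); last exact: norm_continuous.
  apply: (@continuous_comp _ _ _ set_val H).
    exact: (@initial_continuous (set_type Y) X set_val).
  by apply: ctsH; apply/eqP => yp; apply: Yp; rewrite -yp; exact: set_valP.
- by move=> y; rewrite le_min ler01 normr_ge0 ge_min lexx.
have /cvgrPdist_lt/(_ (2^-1)) := cg p; rewrite invr_gt0 ltr0n => /(_ isT).
move=> gp; have : nbhs p [set x | `|g p - g x| < 2^-1] by exact: gp.
rewrite nbhsE => -[B [oB Bp] BgB].
have [n nB] := cvgW B oB Bp.
have gu k : (n <= k)%N -> `|g p - g (\val (u k))| < 2^-1.
  by move=> nk; apply: BgB; exact: nB nk _ (uP k).
(* The indices [n.*2] and [n.*2.+1] give the values 1 and 0, which cannot both be within 1/2 of
   [g p]. *)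
have nn : (n <= n.*2)%N by rewrite -addnn leq_addr.
have := gu _ nn; have := gu _ (leqW nn).
rewrite !gH Hodd Heven normr0 normr1 !ltr_norml minxx.
rewrite min_r ?ler01// => /andP[_ lt1] /andP[lt2 _].
by move: (g p) lt1 lt2 => r; clear; lra.
Qed.

(** * Separating functions from an almost subbase *)

(** Take [b / (a + b)]: the denominator is positive since [a] and [b] have no common zero. *)
Lemma zero_one_quotient (R : realType) (T : topologicalType) (a b : T -> R) :
  continuous a -> continuous b ->
  (forall x, 0 <= a x) -> (forall x, 0 <= b x) ->
  (forall x, a x = 0 -> b x <> 0) ->
  exists g : T -> R, [/\ continuous g, forall x, 0 <= g x <= 1,
    forall x, g x = 1 <-> a x = 0 & forall x, g x = 0 <-> b x = 0].
Proof.
move=> ca cb a0 b0 ab.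
have ab0 x : 0 < a x + b x.
  rewrite lt_neqAle addr_ge0// andbT eq_sym paddr_eq0//.
  by apply/negP => /andP[/eqP/ab + /eqP].
have abn0 x : a x + b x != 0 by rewrite gt_eqF.
exists (fun x => b x / (a x + b x)); split => x.
- apply: cvgM; first exact: cb.
  by apply: cvgV => //; apply: cvgD; [exact: ca|exact: cb].
- by rewrite divr_ge0 ?(ltW (ab0 x))//= ler_pdivrMr// mul1r lerDr.
- split=> [/(congr1 ( *%R^~ (a x + b x)))|ax0].
    by rewrite divfK// mul1r -[LHS]add0r => /addIr.
  by rewrite ax0 add0r divff//; apply/eqP; exact: ab.
- split=> [/eqP|->]; last by rewrite mul0r.
  by rewrite mulf_eq0 invr_eq0 (negbTE (abn0 x)) orbF => /eqP.
Qed.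

Lemma zero_cozero_function (T : topologicalType) (A B : set T) :
  zero_set A -> cozero_set B -> A `<=` B ->
  exists g : T -> (Rdefinitions.R : realType),
    [/\ continuous g, forall x, 0 <= g x <= 1,
    forall x, g x = 1 <-> A x & forall x, g x = 0 <-> ~ B x].
Proof.
move=> [a [ca [a01 ->]]] [b [cb [b01 ->]]] AB.
have [|||||g [cg g01 gA gB]] := @zero_one_quotient _ T a b.
- exact: ca.
- exact: cb.
- by move=> x; have /andP[] := a01 x.
- by move=> x; have /andP[] := b01 x.
- by move=> x /AB.
exists g; split => // x.
by rewrite gB; split=> [bx /(_ bx)|/contrapT].
Qed.

Lemma infinite_set_countable_subset (T : pointedType) (A : set T) :
  infinite_set A -> exists B, [/\ B `<=` A, countable B & infinite_set B].
Proof.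
move=> /infiniteP/ppcard_leP[f]; exists (f @` setT).
have fE : (f @` setT #= [set: nat])%card.
  by apply: inj_card_eq; exact: 'inj_f.
split.
- by move=> _ [n _ <-]; exact: funS.
- by rewrite (eq_countable fE).
- by apply/infiniteP; rewrite (card_le_eqr fE).
Qed.

(** Families are reindexed through [unpickle]; numbers coding no index get the empty family. *)
Lemma F_aleph0_embedded_countable (X : topologicalType) (S : set X)
    (I : countType) (F : I -> set (set X)) :
  (forall i, point_finite (F i)) -> (forall i U, F i U -> open U) ->
  F_separates (\bigcup_i F i) S -> F_aleph0_embedded S.
Proof.
move=> pfF oF sepF; exists (fun k => oapp F set0 (unpickle k)); split.
  move=> k; case: unpickle => [i|] /=; first exact: pfF.
  by move=> x; rewrite (_ : mkset _ = set0)//; apply/seteqP; split=> A [].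
split; first by move=> k U; case: unpickle => [i|] //=; exact: oF.
move=> x y Sx Sy xy; have [U [i _ FU] sepU] := sepF x y Sx Sy xy.
by exists U => //; exists (pickle i) => //; rewrite pickleK.
Qed.

(** [g (V, n)] extends to [X] a function on [Y] that is 1 exactly on the zero-set [U V n.*2] and 0
    exactly off the cozero-set [U V n.*2.+1]. *)
Lemma E_space_separating_functions (X : topologicalType) (Y : set X) :
  is_stone_cech Y -> E_space (set_type Y) ->
  exists (F : nat -> set (set (set_type Y)))
      (g : set (set_type Y) * nat -> X -> (Rdefinitions.R : realType)),
    [/\ forall m n V, F m V -> continuous (g (V, n)),
      forall m n V x, F m V -> 0 <= g (V, n) x,
      forall m n x, finite_set [set V | F m V /\ 0 < g (V, n) x] &
      forall x (y : set_type Y), x <> \val y ->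
        exists m n V, F m V /\ g (V, n) x <> g (V, n) (\val y)].
Proof.
move=> scY [alpha [[U [repU [_ subU]]] [Fn [alphaE spf]]]].
have [cX hX dY _] := scY.
pose R : realType := Rdefinitions.R.
have /choice[g gP] (Vn : set (set_type Y) * nat) : exists g : X -> R,
    alpha Vn.1 -> [/\ continuous g, forall x, 0 <= g x <= 1,
      forall y, g (\val y) = 1 <-> U Vn.1 Vn.2.*2 y &
      forall y, g (\val y) = 0 <-> ~ U Vn.1 Vn.2.*2.+1 y].
  case: Vn => V n /=.
  have [aV|naV] := pselect (alpha V); last by exists (cst 0).
  have [_ [subV [zV cV]]] := repU V aV.
  have [f [cf f01 f1 f0]] := zero_cozero_function _ _ _ (zV n) (cV n) (subV _).
  have [h [ch hf h01]] := @stone_cech_extension R X Y f scY cf f01.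
  by exists h => _; split => // y; rewrite hf.
have g_ge0 V n x : alpha V -> 0 <= g (V, n) x.
  by move=> aV; have [_ /(_ x)/andP[]] := gP (V, n) aV.
have cg V n : alpha V -> continuous (g (V, n)).
  by move=> aV; have [] := gP (V, n) aV.
have oplus V n (q : R) : alpha V -> open [set x | q < g (V, n) x].
  by move=> aV; apply: open_comp (@open_gt R q) => x _; exact: cg.
have ominus V n (q : R) : alpha V -> open [set x | g (V, n) x < q].
  by move=> aV; apply: open_comp (@open_lt R q) => x _; exact: cg.
have posV V n (y : set_type Y) : alpha V -> 0 < g (V, n) (\val y) -> V y.
  move=> aV gy; have [-> _] := repU V aV; exists n.*2.+1 => //.
  apply: contrapT => Uy; have [_ _ _ /(_ y)/= [_ /(_ Uy) g0]] := gP (V, n) aV.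
  by rewrite g0 ltxx in gy.
have alphaFn m V : Fn m V -> alpha V by move=> FV; rewrite alphaE; exists m.
(* An infinite set would contain a finite [G] with empty intersection, but the corresponding
   positivity sets meet in an open set around [x], which has a point of [Y], and this point lies in
   every member of [G]. *)
have fin m n x : finite_set [set V | Fn m V /\ 0 < g (V, n) x].
  apply: contrapT => /infinite_set_countable_subset[S [SF cS iS]].
  have [|G [GS finG [V0 GV0] G0]] := spf m S _ cS iS.
    by move=> V /SF[].
  have [|V /GS/SF[FV gx]|y Gy] := @dense_open_meets X Y
    (\bigcap_(V in G) [set x | 0 < g (V, n) x]) x dY.
  - apply: open_bigcap_finite => // V /GS/SF[FV _].
    by apply: oplus; exact: alphaFn FV.
  - exact: gx.
  suff : (\bigcap_(A in G) A) y by rewrite G0.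
  move=> V GV; have /GS/SF[FV _] := GV.
  by apply: (posV _ n) (Gy _ GV); exact: alphaFn FV.
exists Fn, g; split => //.
- by move=> m n V /alphaFn; exact: cg.
- by move=> m n V x /alphaFn; exact: g_ge0.
move=> x y xy; apply: contrapT => nosep.
have eqg V n : alpha V -> g (V, n) x = g (V, n) (\val y).
  by move=> aV; apply: contrapT => ?; apply: nosep;
  move: (aV); rewrite alphaE => -[m _ FV]; exists m, n, V.
have [|W [oW Wy Wx]] := open_shrink X (~` [set x]) (\val y) cX hX _ (nesym xy).
  apply: closed_openC.
  exact: accessible_closed_set1 (hausdorff_accessible hX) x.
have [|G [finG Gsub Gy GW]] := subU (set_val @^-1` W) y _ Wy.
  by exists W.
(* [N S] is the largest open subset of [X] whose trace on [Y] lies in [S]. *)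
pose N (S : set (set_type Y)) :=
  [set x | forall y : set_type Y, \val y = x -> S y]°.
have NE S A : open A -> A x ->
    (forall y : set_type Y, A (\val y) -> S y) -> N S x.
  move=> oA Ax AS; apply: (@filterS _ (nbhs x) _ A); last exact: open_nbhs_nbhs.
  by move=> z Az y' yz; apply: AS; rewrite yz.
(* Each subbasic [S] around [y] is witnessed by an inequality [g > 0] or [g < 1] at [y]; it
   transfers to [x], where all the functions agree with their values at [y]. *)
have Nx : (\bigcap_(S in G) N S) x.
  move=> S GS; have Sy := Gy _ GS.
  have [aS|[V aV [n _ SE]]] := Gsub _ GS.
    have [SE [mono _]] := repU S aS.
    move: (Sy); rewrite {1}SE => -[k _ Uy].
    have monoU i j : (i <= j)%N -> U S i `<=` U S j.
      elim: j => [|j IH]; first by rewrite leqn0 => /eqP->.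
      rewrite leq_eqVlt => /orP[/eqP->//|/IH]; move/subset_trans; exact.
    (* Doubling the index reaches a zero-set, where [g (S, k)] equals 1. *)
    have {}Uy : U S k.*2 y by apply: monoU Uy; rewrite -addnn leq_addr.
    apply: (NE _ [set x | 0 < g (S, k) x]); first exact: oplus.
      rewrite /= eqg//; have [_ _ /(_ y)/= [_ ->]//] := gP (S, k) aS.
    by move=> y'; exact: posV.
  have [_ /(_ (\val y))/andP[_ g1] g1E _] := gP (V, n) aV.
  apply: (NE _ [set x | g (V, n) x < 1]); first exact: ominus.
    rewrite /= eqg// lt_neqAle g1 andbT; apply/eqP => /g1E Uy.
    by move: Sy; rewrite -SE; exact.
  move=> y' /= g1'; rewrite -SE => /g1E g1''.
  by rewrite g1'' ltxx in g1'.
(* By density some point of [Y] near [x] lies in every [S] of [G], hence in [W], and yet outside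
   [closure W]. *)
have [||y' [NSy nWy]] := @dense_open_meets X Y
  (\bigcap_(S in G) N S `&` ~` closure W) x dY.
- apply: openI; last exact/closed_openC/closed_closure.
  by apply: open_bigcap_finite => // S _; exact: open_interior.
- by split => // /Wx; exact.
apply/nWy/subset_closure/GW => S GS.
by have /interior_subset/(_ y') := NSy _ GS; exact.
Qed.

(** * Separation of all of [X], and the conclusion *)

(** Pairs with a point in [Y] are separated by rational superlevel sets of the functions [g]; two
    points outside [Y] both lie in [Z]. *)
Lemma E_space_F_aleph0_embedded (X : topologicalType) (Y Z : set X) :
  is_stone_cech Y -> E_space (set_type Y) -> Y `|` Z = [set: X] ->
  F_aleph0_embedded Z -> F_aleph0_embedded [set: X].
Proof.
move=> scY EY YZ [FZ [pfZ [oZ sepZ]]].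
have [Fn [g [cg g_ge0 fin sepY]]] := E_space_separating_functions X Y scY EY.
pose R : realType := Rdefinitions.R.
(* A level at least 0 puts each superlevel set inside a positivity set, whence point-finiteness. *)
pose E (i : nat * nat * rat) := [set A | 0 <= i.2 /\
  exists2 V, Fn i.1.1 V & A = [set x | ratr i.2 < g (V, i.1.2) x]].
have sepE x y : (exists m n V, Fn m V /\ g (V, n) x < g (V, n) y) ->
    exists2 A, (exists i, E i A) & A y /\ ~ closure A x.
  move=> [m [n [V [FV /rat_in_itvoo[q]]]]]; rewrite in_itv /= => /andP[xq qy].
  exists [set x | ratr q < g (V, n) x].
    exists (m, n, q); split => /=.
      by have := le_lt_trans (g_ge0 m n V x FV) xq; rewrite ltr0q => /ltW.
    by exists V.
  split => // clx; have : nbhs x [set x | g (V, n) x < ratr q].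
    by apply: open_nbhs_nbhs; split => //;
      apply: open_comp (@open_lt R _) => z _; exact: cg FV z.
  by move=> /clx[z /= [qz zq]]; have := lt_trans qz zq; rewrite ltxx.
apply: (@F_aleph0_embedded_countable X [set: X] (nat * nat * rat + nat)%type
  (fun i => match i with inl j => E j | inr k => FZ k end)).
- move=> [[[m n] q]|k]; last exact: pfZ.
  move=> x; apply: sub_finite_set
    (finite_image (fun V => [set x | ratr q < g (V, n) x]) (fin m n x)).
  move=> A [[/= q0 [V FV ->]] qx]; exists V => //; split => //.
  by apply: le_lt_trans qx; rewrite ler0q.
- move=> [[[m n] q]|k] A /=; last exact: oZ.
  move=> [_ [V FV ->]]; apply: open_comp (@open_gt R _) => z _.
  exact: cg FV z.
have sepXY x (y : set_type Y) : x <> \val y -> exists2 A,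
    (\bigcup_i match i with inl j => E j | inr k => FZ k end) A &
    (A x /\ ~ closure A (\val y)) \/ (A (\val y) /\ ~ closure A x).
  move=> /sepY[m [n [V [FV /eqP]]]]; rewrite neq_lt => /orP[lt|lt].
    have [|A [i EA] Asep] := sepE x (\val y); first by exists m, n, V.
    by exists A; [exists (inl i)|right].
  have [|A [i EA] Asep] := sepE (\val y) x; first by exists m, n, V.
  by exists A; [exists (inl i)|left].
move=> x y _ _ xy.
have [Yy|nYy] := pselect (Y y).
  exact: (sepXY x (exist _ y (mem_set Yy))).
have [Yx|nYx] := pselect (Y x).
  have [A EA Asep] := sepXY y (exist _ x (mem_set Yx)) (nesym xy).
  by exists A => //; apply/or_comm.
have inZ z : ~ Y z -> Z z.
  by move=> nYz; have : (Y `|` Z) z; [rewrite YZ|case].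
have [A [k _ FA] Asep] := sepZ x y (inZ _ nYx) (inZ _ nYy) xy.
by exists A => //; exists (inr k).
Qed.

Theorem theorem4p5 (X : topologicalType) (Y Z : set X) :
  compact (@setT X) -> hausdorff_space X ->
  Y `|` Z = (@setT X) ->
  Y <> (@setT X) -> closure Y = (@setT X) ->
  E_space (set_type Y) ->
  F_aleph0_embedded Z ->
  ~ is_stone_cech Y.
Proof.
move=> cX hX YZ YX dY EY FZ scY.
have [p Yp] : exists p, ~ Y p.
  by apply/existsNP => Yall; apply: YX; apply/seteqP; split.
(* An isolated point would belong to the dense set [Y]. *)
have np : ~ open [set p].
  move=> /(dense_open_meets X Y [set p] p dY)[//|y yp].
  by apply: Yp; rewrite -yp; exact: set_valP.
have [W [oW W0 disjW cvgW]] := convergent_open_sets X p cX hX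
  (E_space_F_aleph0_embedded X Y Z scY EY YZ FZ) np.
exact: (stone_cech_no_convergent_open_sets Rdefinitions.R X Y p W).
Qed.
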